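(* Let $(\mathfrak{g},\langle\cdot,\cdot\rangle)$ be a completely solvable unimodular Lorentzian Lie algebra whose center $Z(\mathfrak{g})$ is nonzero and degenerate (the restriction of $\langle\cdot,\cdot\rangle$ to it is degenerate). Then $\mathfrak{g}$ is Einstein if and only if it is (isometrically isomorphic to a Lorentzian Lie algebra) obtained by a double extension process from an abelian Euclidean Lie algebra with admissible parameters $(K,D,0,b)$. In particular, if $\mathfrak{g}$ is Einstein then it is Ricci-flat.
   Context: A Lorentzian Lie algebra is a finite-dimensional real Lie algebra with a nondegenerate symmetric bilinear form of signature $(1,n-1)$. $\mathfrak{g}$ is completely solvable if there is a chain of ideals $0=I_0\subset I_1\subset\cdots\subset I_n=\mathfrak{g}$ with $\dim I_i=i$; unimodular means $\mathrm{tr}(\mathrm{ad}_u)=0$ for all $u$. Double extension of a Euclidean Lie algebra $(\mathfrak{g}_0,[\cdot,\cdot]_0,\langle\cdot,\cdot\rangle_0)$ with parameters $(K,D,\mu,b)$ ($K,D$ endomorphisms of $\mathfrak{g}_0$, $K$ skew-symmetric, $\mu\in\mathbb{R}$, $b\in\mathfrak{g}_0$): $\mathfrak{g}=\mathbb{R}e\oplus\mathfrak{g}_0\oplus\mathbb{R}\bar e$ with $\langle e,e\rangle=\langle\bar e,\bar e\rangle=0$, $\langle e,\bar e\rangle=1$, $\mathfrak{g}_0\perp\{e,\bar e\}$, $\langle\cdot,\cdot\rangle|_{\mathfrak{g}_0}=\langle\cdot,\cdot\rangle_0$, and skew-symmetric bracket $[\bar e,e]=\mu e$, $[\bar e,u]=D(u)+\langle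 b,u\rangle_0e$, $[u,v]=[u,v]_0+\langle K(u),v\rangle_0e$, $[e,u]=0$ ($u,v\in\mathfrak{g}_0$). For $\mathfrak{g}_0$ abelian, the parameters are called admissible when this bracket is a Lie bracket and the resulting Lorentzian Lie algebra is Einstein; equivalently, $KD+D^*K=\mu K$ and $4\mu\,\mathrm{tr}(D)-2\mathrm{tr}(D^2)-2\mathrm{tr}(DD^* )-\mathrm{tr}(K^2)=0$ (adjoints with respect to $\langle\cdot,\cdot\rangle_0$). Einstein means the Ricci operator $\mathrm{Ric}$ of the Levi-Civita connection (given by $2\langle \mathrm{L}_uv,w\rangle=\langle[u,v],w\rangle+\langle[w,u],v\rangle+\langle[w,v],u\rangle$, curvature $\mathrm{L}_{[u,v]}-[\mathrm{L}_u,\mathrm{L}_v]$, $\langle\mathrm{Ric}(u),v\rangle=\mathrm{tr}(w\mapsto K(u,w)v)$) equals $\lambda\mathrm{Id}$ for some $\lambda$; Ricci-flat means $\mathrm{Ric}=0$. *)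

(* Defs.v *)
From HB Require Import structures.
From mathcomp Require Import all_boot all_order all_algebra.
From mathcomp Require Import reals.
Set Implicit Arguments. Unset Strict Implicit. Unset Printing Implicit Defensive.
Import Order.TTheory GRing.Theory Num.Theory.
Local Open Scope ring_scope.

(* A Lie algebra of dimension n is modelled on 'rV[R]_n with a bracket
   br : 'rV_n -> 'rV_n -> 'rV_n; endomorphisms act on row vectors on the
   right (u |-> u *m A).  A scalar product is given by its Gram matrix G. *)

Section Lorentz.
Variable R : realType.

Definition bvec {n : nat} (i : 'I_n) : 'rV[R]_n := delta_mx 0 i.

Definition form {n : nat} (G : 'M[R]_n) (u v : 'rV[R]_n) : R :=
  (u *m G *m v^T) 0 0.

Definition is_lie_bracket {n : nat} (br : 'rV[R]_n -> 'rV[R]_n -> 'rV[R]_n) :=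
  [/\ forall (a : R) u v w, br (a *: u + v) w = a *: br u w + br v w,
      forall u v, br u v = - br v u
    & forall u v w, br u (br v w) + br v (br w u) + br w (br u v) = 0].

(* Lorentzian metric: symmetric, signature (1, n-1) i.e. congruent to
   diag(-1, 1, ..., 1) (this also forces nondegeneracy) *)
Definition lorentzian {n : nat} (G : 'M[R]_n) :=
  G^T = G /\
  exists P : 'M[R]_n, P \in unitmx /\
    P *m G *m P^T = diag_mx (\row_(i < n) if val i == 0%N then -1 else 1).

Definition euclidean {m : nat} (G0 : 'M[R]_m) :=
  G0^T = G0 /\ forall u : 'rV[R]_m, u != 0 -> 0 < form G0 u u.

Definition ad_mx {n : nat} (br : 'rV[R]_n -> 'rV[R]_n -> 'rV[R]_n) (u : 'rV[R]_n)
  : 'M[R]_n := \matrix_(i < n) br u (bvec i).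

Definition unimodular {n : nat} (br : 'rV[R]_n -> 'rV[R]_n -> 'rV[R]_n) :=
  forall u, \tr (ad_mx br u) = 0.

Definition is_ideal {n : nat} (br : 'rV[R]_n -> 'rV[R]_n -> 'rV[R]_n) (I : 'M[R]_n) :=
  forall u v : 'rV[R]_n, (u <= I)%MS -> (br v u <= I)%MS.

Definition completely_solvable {n : nat} (br : 'rV[R]_n -> 'rV[R]_n -> 'rV[R]_n) :=
  exists I : 'I_n.+1 -> 'M[R]_n,
    [/\ forall i, \rank (I i) = i,
        forall i j : 'I_n.+1, (i <= j)%N -> (I i <= I j)%MS
      & forall i, is_ideal br (I i)].

Definition central {n : nat} (br : 'rV[R]_n -> 'rV[R]_n -> 'rV[R]_n) (u : 'rV[R]_n) :=
  forall v, br u v = 0.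

Definition center_nonzero {n : nat} (br : 'rV[R]_n -> 'rV[R]_n -> 'rV[R]_n) :=
  exists u, u != 0 /\ central br u.

Definition center_degenerate {n : nat} (G : 'M[R]_n)
  (br : 'rV[R]_n -> 'rV[R]_n -> 'rV[R]_n) :=
  exists z, [/\ z != 0, central br z & forall w, central br w -> form G z w = 0].

(* Levi-Civita product: the unique L_u v with
   2 <L_u v, w> = <[u,v],w> + <[w,u],v> + <[w,v],u>  (G invertible) *)
Definition LC {n : nat} (br : 'rV[R]_n -> 'rV[R]_n -> 'rV[R]_n) (G : 'M[R]_n)
  (u v : 'rV[R]_n) : 'rV[R]_n :=
  (2^-1 *: \row_(j < n) (form G (br u v) (bvec j) + form G (br (bvec j) u) v
                         + form G (br (bvec j) v) u)) *m invmx G.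

Definition curv {n : nat} (br : 'rV[R]_n -> 'rV[R]_n -> 'rV[R]_n) (G : 'M[R]_n)
  (u v w : 'rV[R]_n) : 'rV[R]_n :=
  LC br G (br u v) w - (LC br G u (LC br G v w) - LC br G v (LC br G u w)).

Definition ric_form {n : nat} (br : 'rV[R]_n -> 'rV[R]_n -> 'rV[R]_n) (G : 'M[R]_n)
  (u v : 'rV[R]_n) : R :=
  \tr (\matrix_(i < n) curv br G u (bvec i) v).

(* Ricci operator: <Ric u, v> = ric u v *)
Definition Ric {n : nat} (br : 'rV[R]_n -> 'rV[R]_n -> 'rV[R]_n) (G : 'M[R]_n)
  (u : 'rV[R]_n) : 'rV[R]_n :=
  (\row_(j < n) ric_form br G u (bvec j)) *m invmx G.

Definition einstein {n : nat} (br : 'rV[R]_n -> 'rV[R]_n -> 'rV[R]_n) (G : 'M[R]_n) :=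
  exists lambda : R, forall u, Ric br G u = lambda *: u.

Definition ricci_flat {n : nat} (br : 'rV[R]_n -> 'rV[R]_n -> 'rV[R]_n) (G : 'M[R]_n) :=
  forall u, Ric br G u = 0.

Definition isometric_iso {n k : nat}
  (br : 'rV[R]_n -> 'rV[R]_n -> 'rV[R]_n) (G : 'M[R]_n)
  (br' : 'rV[R]_k -> 'rV[R]_k -> 'rV[R]_k) (G' : 'M[R]_k) :=
  exists (f : 'M[R]_(n, k)) (g : 'M[R]_(k, n)),
    [/\ f *m g = 1%:M, g *m f = 1%:M,
        forall x y, br' (x *m f) (y *m f) = br x y *m f
      & forall x y, form G' (x *m f) (y *m f) = form G x y].

(* ---- Double extension of the abelian Euclidean Lie algebra (R^m, G0) ----
   g = R e (+) g0 (+) R ebar, coordinates: index 0 = e, then g0, last = ebar. *)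
Definition de_e {m : nat} (x : 'rV[R]_(1 + m + 1)) : R :=
  x 0 (lshift 1 (lshift m (ord0 : 'I_1))).
Definition de_mid {m : nat} (x : 'rV[R]_(1 + m + 1)) : 'rV[R]_m :=
  \row_(i < m) x 0 (lshift 1 (rshift 1 i)).
Definition de_ebar {m : nat} (x : 'rV[R]_(1 + m + 1)) : R :=
  x 0 (rshift (1 + m) (ord0 : 'I_1)).
Definition de_mk {m : nat} (a : R) (u : 'rV[R]_m) (b : R) : 'rV[R]_(1 + m + 1) :=
  row_mx (row_mx (a%:M : 'rV[R]_1) u) (b%:M : 'rV[R]_1).

(* bilinear skew extension of
   [ebar,e] = mu e, [ebar,u] = D u + <b,u>_0 e, [u,v] = <K u, v>_0 e, [e,u] = 0 *)
Definition de_br {m : nat} (G0 K D : 'M[R]_m) (mu : R) (b : 'rV[R]_m)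
  (x y : 'rV[R]_(1 + m + 1)) : 'rV[R]_(1 + m + 1) :=
  let a := de_e x in let u := de_mid x in let al := de_ebar x in
  let c := de_e y in let v := de_mid y in let be := de_ebar y in
  de_mk (form G0 (u *m K) v + al * form G0 b v - be * form G0 b u
         + mu * (al * c - a * be))
        (al *: (v *m D) - be *: (u *m D)) 0.

Definition de_form {m : nat} (G0 : 'M[R]_m) (x y : 'rV[R]_(1 + m + 1)) : R :=
  de_e x * de_ebar y + de_ebar x * de_e y + form G0 (de_mid x) (de_mid y).

Definition de_G {m : nat} (G0 : 'M[R]_m) : 'M[R]_(1 + m + 1) :=
  \matrix_(i, j) de_form G0 (bvec i) (bvec j).

Definition skew_wrt {m : nat} (G0 K : 'M[R]_m) :=
  forall u v : 'rV[R]_m, form G0 (u *m K) v = - form G0 u (v *m K).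

Definition admissible {m : nat} (G0 K D : 'M[R]_m) (mu : R) (b : 'rV[R]_m) :=
  is_lie_bracket (de_br G0 K D mu b) /\ einstein (de_br G0 K D mu b) (de_G G0).

End Lorentz.

(* Main.v *)
(** Let z be the null central vector orthogonal to the center, and let R_u be
    w |-> L_w u.  Unimodularity gives ric(u,v) = - tr (R_u R_v).  In a frame
    e = z, an orthonormal basis of g0, ebar, each vanishing of the Ricci form
    becomes the vanishing of a sum of squares:
    - ric(z,z) = 0 gives <[u,v],z> = 0 for u, v in z^perp, and then ric(z,ebar)
      = 0 forces lambda = 0;
    - with <[u,ebar],z> = <a,u>, the Jacobi identity gives <[u,v],a> = 0 on g0,
      and ric(a,a) = 0 gives a = 0, so that z^perp contains [g,g];
    - summing ric(e_k,e_k) = 0 over g0, where tr (ad_u)^2 >= 0 because the ad_u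
      are simultaneously triangular, shows that z^perp / z is abelian.
    What is left of the bracket is that of a double extension with mu = 0. *)

Require Import Defs.
From HB Require Import structures.
From mathcomp Require Import all_boot all_order all_algebra.
From mathcomp Require Import reals.
From mathcomp Require Import ring lra.
Import Order.TTheory GRing.Theory Num.Theory.
Local Open Scope ring_scope.

Local Notation bvec i := (Defs.bvec _ i).
(* MathComp's sesquilinear library also defines [form]. *)
Local Notation form := Defs.form.

(** * Bilinear forms, linear maps as matrices, and reflections *)

Section Form.
Context {R : realType} {n : nat}.
Implicit Types (G : 'M[R]_n) (u v w x y : 'rV[R]_n).

Lemma bvec_mul {k} (i : 'I_n) (A : 'M[R]_(n, k)) : bvec i *m A = row i A.
Proof. by rewrite rowE. Qed.

Lemma sum_bvec u : u = \sum_i u 0 i *: bvec i.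
Proof. exact: row_sum_delta. Qed.

Lemma formE G u v : form G u v = (u *m G *m v^T) 0 0.
Proof. by []. Qed.

Lemma formDl G u v w : form G (u + v) w = form G u w + form G v w.
Proof. by rewrite /form !mulmxDl mxE. Qed.

Lemma formZl G a u w : form G (a *: u) w = a * form G u w.
Proof. by rewrite /form -!scalemxAl mxE. Qed.

Lemma formDr G u v w : form G u (v + w) = form G u v + form G u w.
Proof. by rewrite /form linearD mulmxDr mxE. Qed.

Lemma formZr G a u w : form G u (a *: w) = a * form G u w.
Proof. by rewrite /form linearZ -scalemxAr mxE. Qed.

Lemma form0l G u : form G 0 u = 0.
Proof. by rewrite -(scale0r 0) formZl mul0r. Qed.

Lemma formNl G u v : form G (- u) v = - form G u v.
Proof. by rewrite -scaleN1r formZl mulN1r. Qed.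

Lemma formBl G u v w : form G (u - v) w = form G u w - form G v w.
Proof. by rewrite formDl formNl. Qed.

Lemma formNr G u v : form G u (- v) = - form G u v.
Proof. by rewrite -scaleN1r formZr mulN1r. Qed.

Lemma form_sym G u v : G^T = G -> form G u v = form G v u.
Proof.
move=> Gs; rewrite /form -[in RHS]Gs -[v in RHS]trmxK -!trmx_mul mulmxA.
by rewrite [RHS]mxE.
Qed.

Lemma form_bvec G x j : form G x (bvec j) = (x *m G) 0 j.
Proof. by rewrite /form trmx_delta -colE mxE. Qed.

Lemma form_inj G x y : G \in unitmx ->
  (forall w, form G x w = form G y w) -> x = y.
Proof.
move=> Gu h; apply: (can_inj (mulmxK Gu)); apply/rowP=> j.
by rewrite -!form_bvec h.
Qed.

Lemma linear_sum_bvec (V : lmodType R) (phi : 'rV[R]_n -> V) :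
  (forall a u v, phi (a *: u + v) = a *: phi u + phi v) ->
  forall w, \sum_j w 0 j *: phi (bvec j) = phi w.
Proof.
move=> lin w; have phi0 : phi 0 = 0.
  have := lin 1 0 0; rewrite !scale1r addr0 => /eqP.
  by rewrite -subr_eq0 opprD addrA subrr sub0r oppr_eq0 => /eqP.
rewrite [in RHS](sum_bvec w).
elim/big_rec2: _ => [|i a b _ IH]; first by rewrite phi0.
by rewrite lin IH.
Qed.

(** With vectors acting on the left, a linear map is the matrix whose rows are the images of the
    basis; [ad_mx], [LCl] and [LCr] are all used through this fact. *)
Lemma mul_rows_linear k (phi : 'rV[R]_n -> 'rV[R]_k) :
  (forall a u v, phi (a *: u + v) = a *: phi u + phi v) ->
  forall w, w *m (\matrix_i phi (bvec i)) = phi w.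
Proof.
move=> lin w; rewrite mulmx_sum_row -(linear_sum_bvec _ _ lin w).
by apply: eq_bigr => i _; rewrite rowK.
Qed.

Lemma mul_gramE k (F : 'M[R]_(k, n)) G i j :
  (F *m G *m F^T) i j = form G (row i F) (row j F).
Proof.
rewrite /form -row_mul mxE [RHS]mxE; apply: eq_bigr => l _.
by rewrite [row i _ _ _]mxE [F^T _ _]mxE [_^T _ _]mxE [row j F _ _]mxE.
Qed.

Lemma mxtrace_rows_linear a (phi psi chi : 'I_n -> 'rV[R]_n) :
  (forall i, phi i = a *: psi i + chi i) ->
  \tr (\matrix_i phi i) = a * \tr (\matrix_i psi i) + \tr (\matrix_i chi i).
Proof.
move=> h; rewrite -mxtraceZ -mxtraceD; congr (\tr _).
by apply/matrixP => i j; rewrite !mxE h !mxE.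
Qed.

(** Two vectors of equal norm are exchanged by the reflection in the hyperplane orthogonal to their
    difference, provided that difference is not null. *)
Lemma reflection_isometry G x y (v := y - x) :
  G^T = G -> form G x x = form G y y -> form G v v != 0 ->
  exists S : 'M[R]_n, S *m G *m S^T = G /\ x *m S = y.
Proof.
move=> Gs xy v0; pose s := form G v v.
exists (1%:M - (2 / s) *: (G *m v^T *m v)).
have vGv : v *m G *m v^T = s%:M by rewrite [LHS]mx11_scalar.
split.
  have -> : (1%:M - (2 / s) *: (G *m v^T *m v))^T =
            1%:M - (2 / s) *: (v^T *m v *m G).
    have -> : v^T *m v *m G = (G *m v^T *m v)^T.
      by rewrite !trmx_mul trmxK Gs mulmxA.
    by apply/matrixP => i j; rewrite ![in LHS]mxE ![in RHS]mxE eq_sym.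
  rewrite mulmxBl mul1mx mulmxBr mulmx1 -scalemxAl mulmxBl.
  rewrite -scalemxAr -scalemxAl -scalemxAr !mulmxA.
  (* The quadratic term contains the scalar [v *m G *m v^T = s], which turns its factor (2/s)^2 into
     2(2/s); it then cancels the two linear terms. *)
  rewrite -(mulmxA _ v G) -(mulmxA _ (v *m G)) vGv mul_mx_scalar.
  rewrite -scalemxAl !scalerA !mulmxA.
  rewrite -scalemxAl; set A := _ *m G; apply/matrixP => i j.
  by rewrite !mxE; field.
rewrite mulmxBr mulmx1 -scalemxAr !mulmxA.
rewrite (mx11_scalar (x *m G *m v^T)) mul_scalar_mx -formE scalerA.
(* Equality of the norms gives <x, v> = -s/2, so the reflection sends x to x + v = y. *)
suff -> : 2 / s * form G x v = -1 by rewrite scaleN1r opprK addrC subrK.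
have -> : form G x v = - (s / 2).
  by rewrite /s /v !formBl !formDr !formNr (form_sym _ _ _ Gs) xy; field.
by field.
Qed.

End Form.

(** * Levi-Civita product, curvature and the Ricci form *)

Section LeviCivita.
Context {R : realType} {n : nat} (br : 'rV[R]_n -> 'rV[R]_n -> 'rV[R]_n).
Variable G : 'M[R]_n.
Hypotheses (lie : is_lie_bracket br) (Gs : G^T = G) (Gu : G \in unitmx).
Implicit Types u v w x y : 'rV[R]_n.

Lemma br_linl a u v w : br (a *: u + v) w = a *: br u w + br v w.
Proof. by case: lie. Qed.

Lemma br_skew u v : br u v = - br v u.
Proof. by case: lie. Qed.

Lemma br_linr a u v w : br w (a *: u + v) = a *: br w u + br w v.
Proof.
by rewrite br_skew br_linl opprD -scalerN -!br_skew.
Qed.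

Lemma mul_ad_mx u w : w *m ad_mx br u = br u w.
Proof. by apply: mul_rows_linear => a x y; apply: br_linr. Qed.

(** The Koszul formula: the definition imposes it against basis vectors only, and linearity in [w]
    gives the rest. *)
Lemma LC_form u v w : form G (LC br G u v) w =
  2^-1 * (form G (br u v) w + form G (br w u) v + form G (br w v) u).
Proof.
pose phi w : R^o :=
  2^-1 * (form G (br u v) w + form G (br w u) v + form G (br w v) u).
rewrite -[RHS]/(phi w) -(linear_sum_bvec _ phi); last first.
  move=> a x y; rewrite /phi !br_linl !(formDl, formZl, formDr, formZr).
  by rewrite /GRing.scale /=; ring.
rewrite {1}/form /LC mulmxKV // mxE; apply: eq_bigr => j _.
by rewrite !mxE mulrC.
Qed.

Lemma LC_linl a u v w :
  LC br G (a *: u + v) w = a *: LC br G u w + LC br G v w.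
Proof.
apply: (form_inj _ _ _ Gu) => x.
rewrite formDl formZl !LC_form br_linl br_linr !(formDl, formZl, formDr, formZr).
by ring.
Qed.

Lemma LC_linr a u v w :
  LC br G w (a *: u + v) = a *: LC br G w u + LC br G w v.
Proof.
apply: (form_inj _ _ _ Gu) => x.
rewrite formDl formZl !LC_form !br_linr !(formDl, formZl, formDr, formZr).
by ring.
Qed.

Lemma LC_torsion_free u v : LC br G u v - LC br G v u = br u v.
Proof.
apply: (form_inj _ _ _ Gu) => x.
rewrite formBl !LC_form (br_skew v u) formNl.
by field.
Qed.

Lemma LC_metric u v w : form G (LC br G u v) w = - form G v (LC br G u w).
Proof.
rewrite (form_sym _ v _ Gs) !LC_form (br_skew w u) (br_skew w v) (br_skew v u).
by rewrite !formNl; ring.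
Qed.

Definition LCl u : 'M[R]_n := \matrix_i LC br G u (bvec i).
Definition LCr u : 'M[R]_n := \matrix_i LC br G (bvec i) u.

Lemma mul_LCl u w : w *m LCl u = LC br G u w.
Proof. by apply: mul_rows_linear => *; apply: LC_linr. Qed.

Lemma mul_LCr u w : w *m LCr u = LC br G w u.
Proof.
by apply: (mul_rows_linear _ (fun w => LC br G w u)) => *; apply: LC_linl.
Qed.

(** Compatibility with the metric makes L_u skew-adjoint, hence conjugate by [G] to minus its
    transpose. *)
Lemma mxtrace_LCl u : \tr (LCl u) = 0.
Proof.
have skew : LCl u *m G = - (G *m (LCl u)^T).
  apply/row_matrixP => i; apply/rowP => j.
  rewrite !rowE mulmxA mul_LCl -form_bvec LC_metric.
  by rewrite formE -mul_LCl trmx_mul mulmxA trmx_delta -colE -mulmxA bvec_mul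
    -rowE !mxE.
have := congr1 (fun M => \tr (M *m invmx G)) skew.
rewrite /= mulmxK // mulNmx raddfN /= mxtrace_mulC mulmxA mulVmx // mul1mx.
by rewrite mxtrace_tr; lra.
Qed.

(** Torsion-freeness gives R_u = L_u - ad_u, and both terms are traceless. *)
Lemma mxtrace_LCr u : unimodular br -> \tr (LCr u) = 0.
Proof.
move=> um.
have -> : LCr u = LCl u - ad_mx br u.
  by apply/row_matrixP => i; rewrite linearB /= !rowK -LC_torsion_free subKr.
by rewrite linearB /= mxtrace_LCl um subr0.
Qed.

Let linear_comb_sub a (p q r s t z : 'rV[R]_n) :
  (a *: p + q) - ((a *: r + s) - (a *: t + z)) = a *: (p - (r - t)) + (q - (s - z)).
Proof. by apply/rowP => i; rewrite !mxE; ring. Qed.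

Lemma curv_linm a u v w x :
  curv br G u (a *: v + w) x = a *: curv br G u v x + curv br G u w x.
Proof. by rewrite /curv br_linr !LC_linl LC_linr linear_comb_sub. Qed.

Lemma curv_linr a u v w x :
  curv br G u x (a *: v + w) = a *: curv br G u x v + curv br G u x w.
Proof. by rewrite /curv !LC_linr linear_comb_sub. Qed.

Lemma ric_linr a u v w :
  ric_form br G u (a *: v + w) = a * ric_form br G u v + ric_form br G u w.
Proof.
by apply: mxtrace_rows_linear => i; apply: curv_linr.
Qed.

(** Writing [u, w] as L_u w - R_u w expresses the operator w |-> curv u w v through L_u, R_u, R_v
    and R_{L_u v}. In the trace the two products of L_u with R_v cancel, and R_{L_u v} is traceless
    by unimodularity. *)
Lemma ric_unimodular u v : unimodular br ->
  ric_form br G u v = - \tr (LCr u *m LCr v).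
Proof.
move=> um.
pose M := (LCl u - LCr u) *m LCr v - (LCr v *m LCl u - LCr (LC br G u v)).
have e w : w *m M = curv br G u w v.
  rewrite /M 2!mulmxBr !mulmxA mulmxBr (mul_LCl u) (mul_LCr u).
  rewrite LC_torsion_free (mul_LCr v) (mul_LCr v) (mul_LCl u).
  by rewrite (mul_LCr (LC br G u v)).
have -> : ric_form br G u v = \tr M.
  by congr (\tr _); apply/row_matrixP => i; rewrite rowK rowE e.
rewrite /M !linearB /= mxtrace_LCr // subr0 mulmxBl linearB /=.
by rewrite (mxtrace_mulC (LCl u)) addrC addKr.
Qed.

Lemma einsteinP lambda : (forall u, Ric br G u = lambda *: u) <->
  (forall u v, ric_form br G u v = lambda * form G u v).
Proof.
split=> h u.
  move=> v; have /(congr1 (fun x => x *m G)) := h u.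
  rewrite /Ric mulmxKV // => e.
  rewrite -formZl formE -e mxE.
  have := linear_sum_bvec (R^o) (ric_form br G u) (fun a x y => ric_linr a u x y) v.
  by move=> <-; apply: eq_bigr => j _; rewrite !mxE mulrC.
apply: (can_inj (mulmxK Gu)); rewrite /Ric mulmxKV //; apply/rowP => j.
by rewrite mxE h -scalemxAl mxE form_bvec.
Qed.

End LeviCivita.

(** * Transport of brackets, curvature and the Einstein condition along isometries *)

Section IsometricIso.
Context {R : realType}.

Lemma isometric_iso_sym {n k : nat} (br : 'rV[R]_n -> 'rV[R]_n -> 'rV[R]_n) G
    (br' : 'rV[R]_k -> 'rV[R]_k -> 'rV[R]_k) G' :
  isometric_iso br G br' G' -> isometric_iso br' G' br G.
Proof.
case=> f [g [fg gf hbr hG]]; exists g, f; split=> // x y.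
  by rewrite -[in LHS](mulmx1 (br _ _)) -fg mulmxA -hbr -!mulmxA gf !mulmx1.
by rewrite -hG -!mulmxA gf !mulmx1.
Qed.

Context {n k : nat} (br : 'rV[R]_n -> 'rV[R]_n -> 'rV[R]_n) (G : 'M[R]_n).
Context (br' : 'rV[R]_k -> 'rV[R]_k -> 'rV[R]_k) (G' : 'M[R]_k).
Context (f : 'M[R]_(n, k)) (g : 'M[R]_(k, n)).
Hypotheses (fg : f *m g = 1%:M) (gf : g *m f = 1%:M).
Hypotheses (hbr : forall x y, br' (x *m f) (y *m f) = br x y *m f)
  (hG : forall x y, form G' (x *m f) (y *m f) = form G x y).
Hypotheses (lie : is_lie_bracket br) (Gs : G^T = G) (Gu : G \in unitmx).

Let gfK m (x : 'M[R]_(m, k)) : x *m g *m f = x.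
Proof. by rewrite -mulmxA gf mulmx1. Qed.

Lemma iso_br x y : br' x y = br (x *m g) (y *m g) *m f.
Proof. by rewrite -hbr !gfK. Qed.

Lemma iso_lie : is_lie_bracket br'.
Proof.
case: lie => lin sk jac; split.
- by move=> a u v w; rewrite !iso_br mulmxDl -scalemxAl lin mulmxDl scalemxAl.
- by move=> u v; rewrite !iso_br sk mulNmx.
- move=> u v w; rewrite !iso_br.
  by rewrite -!(mulmxA _ f g) fg !mulmx1 -!mulmxDl jac mul0mx.
Qed.

Lemma iso_gram : G' = g *m G *m g^T.
Proof.
apply/matrixP => i j.
have := hG (bvec i *m g) (bvec j *m g); rewrite !gfK form_bvec bvec_mul mxE => ->.
by rewrite formE trmx_mul trmx_delta !mulmxA -colE -!mulmxA bvec_mul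
  [LHS]mxE [LHS]mxE.
Qed.

(** Nondegeneracy is transported by exhibiting the inverse Gram matrix [f^T *m invmx G *m f]. *)
Lemma iso_unit : G' \in unitmx.
Proof.
have e : G' *m (f^T *m invmx G *m f) = 1%:M.
  rewrite iso_gram !mulmxA -(mulmxA (g *m G)) -trmx_mul fg trmx1 mulmx1.
  by rewrite mulmxK.
by case: (mulmx1_unit e).
Qed.

Lemma iso_ad_mx x : ad_mx br' (x *m f) = g *m ad_mx br x *m f.
Proof.
apply/row_matrixP => i.
by rewrite rowK rowE !mulmxA mul_ad_mx // -hbr gfK.
Qed.

Lemma iso_unimodular : unimodular br -> unimodular br'.
Proof.
move=> um u; rewrite -(gfK _ u) iso_ad_mx mxtrace_mulC mulmxA fg mul1mx.
exact: um.
Qed.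

Lemma iso_trace_ad_sqr x :
  \tr (ad_mx br' (x *m f) *m ad_mx br' (x *m f)) =
  \tr (ad_mx br x *m ad_mx br x).
Proof.
rewrite iso_ad_mx !mulmxA -(mulmxA (g *m _)) fg mulmx1 mxtrace_mulC.
by rewrite !mulmxA fg mul1mx.
Qed.

(** Both sides satisfy the same Koszul formula, which determines the product because [G'] is
    nondegenerate. *)
Lemma iso_LC x y : LC br' G' (x *m f) (y *m f) = LC br G x y *m f.
Proof.
apply: (form_inj _ _ _ iso_unit) => w; rewrite -(gfK _ w) hG.
rewrite (LC_form _ _ iso_lie iso_unit) (LC_form _ _ lie Gu).
by rewrite !hbr !hG.
Qed.

Lemma iso_curv x y z :
  curv br' G' (x *m f) (y *m f) (z *m f) = curv br G x y z *m f.
Proof. by rewrite /curv hbr !iso_LC !mulmxBl. Qed.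

Lemma iso_ric x y : ric_form br' G' (x *m f) (y *m f) = ric_form br G x y.
Proof.
rewrite /ric_form.
(* Inserting [f *m g = 1] and using cyclicity replaces the curvature operator by its conjugate on
   the target space. *)
rewrite -[RHS](congr1 mxtrace (mul1mx _)) -fg -mulmxA -mxtrace_mulC.
congr (\tr _); apply/row_matrixP => i; rewrite rowK rowE !mulmxA.
rewrite (mul_rows_linear _ (fun v => curv br G x v y)) -?iso_curv ?gfK //.
by move=> *; apply: curv_linm.
Qed.

Lemma iso_einstein lambda : (forall u, Ric br G u = lambda *: u) ->
  (forall u, Ric br' G' u = lambda *: u).
Proof.
move=> /(einsteinP br G lie Gu lambda) h.
apply/(einsteinP br' G' iso_lie iso_unit lambda) => u v.
by rewrite -(gfK _ u) -(gfK _ v) iso_ric h hG.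
Qed.

End IsometricIso.

(** * Traces of squares of operators preserving a full flag *)

Section Flags.
Context {F : fieldType} {n : nat}.

(* A basis adapted to the flag triangularizes A, and d is the diagonal. *)
Lemma mxtrace_sqr_flag (A : 'M[F]_n) (I : 'I_n.+1 -> 'M[F]_n) :
    (forall i, \rank (I i) = i) ->
    (forall i j : 'I_n.+1, (i <= j)%N -> (I i <= I j)%MS) ->
    (forall i, (I i *m A <= I i)%MS) ->
  exists d : 'I_n -> F, \tr (A *m A) = \sum_i d i ^+ 2.
Proof.
move=> rkI leI stI.
pose lo (i : 'I_n) : 'I_n.+1 := widen_ord (leqnSn n) i.
pose hi (i : 'I_n) : 'I_n.+1 := lift ord0 i.
have ex i : exists v : 'rV_n, (v <= I (hi i))%MS && ~~ (v <= I (lo i))%MS.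
  have /row_subPn[j hj] : ~~ (I (hi i) <= I (lo i))%MS.
    by apply/negP => /mxrankS; rewrite !rkI /= /bump /= add1n ltnn.
  by exists (row j (I (hi i))); rewrite row_sub.
have [v hv] : {v : 'I_n -> 'rV_n | forall i,
    (v i <= I (hi i))%MS && ~~ (v i <= I (lo i))%MS}.
  by exists (fun i => xchoose (ex i)) => i; apply: (xchooseP (ex i)).
(* Only the first k adapted vectors are kept; zero rows keep the matrix square for every k. *)
pose B k : 'M[F]_n := \matrix_(i < n) (if (i < k)%N then v i else 0).
have IB k (hk : (k < n.+1)%N) : (I (Ordinal hk) <= B k)%MS.
  elim: k hk => [|k IH] hk.
    by have /eqP := rkI (Ordinal hk); rewrite mxrank_eq0 => /eqP ->; apply: sub0mx.
  pose i := Ordinal (hk : (k < n)%N).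
  have -> : Ordinal hk = hi i by apply: val_inj.
  have [vhi vlo] := andP (hv i).
  have le1 : (I (lo i) + v i <= I (hi i))%MS.
    by rewrite addsmx_sub vhi andbT leI //= /bump leq0n leqnSn.
  have lt1 : (I (lo i) < I (lo i) + v i)%MS.
    by rewrite ltmxE addsmxSl /= addsmx_sub submx_refl.
  (* Adjoining [v i] strictly raises the rank from i, so the sum already has the rank i + 1 of the
     next flag member. *)
  have le2 : (I (hi i) <= I (lo i) + v i)%MS.
    rewrite -(geq_leqif (mxrank_leqif_sup le1)) rkI.
    by have := rank_ltmx lt1; rewrite rkI.
  apply: submx_trans le2 _; rewrite addsmx_sub; apply/andP; split.
    have -> : lo i = Ordinal (ltnW hk) by apply: val_inj.
    apply: submx_trans (IH _) _; apply/row_subP => j; rewrite rowK.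
    case: ifP => [jk|_]; last exact: sub0mx.
    by have := row_sub j (B k.+1); rewrite rowK (ltnW (jk : (j.+1 < k.+1)%N)).
  by have := row_sub i (B k.+1); rewrite rowK ltnSn.
have Bu : B n \in unitmx.
  rewrite -row_full_unit -sub1mx; apply: submx_trans (IB n (ltnSn n)).
  by rewrite sub1mx /row_full rkI.
pose T := B n *m A *m invmx (B n).
have Tlow (i j : 'I_n) : (i < j)%N -> T i j = 0.
  move=> ij; have [vhi _] := andP (hv i).
  have : (row i (B n) *m A <= B i.+1)%MS.
    have -> : row i (B n) = v i by rewrite rowK ltn_ord.
    apply: submx_trans (submxMr _ vhi) _; apply: submx_trans (stI _) _.
    have -> : hi i = Ordinal (ltn_ord i : (i.+1 < n.+1)%N) by apply: val_inj.
    exact: IB.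
  case/submxP => y hy.
  (* In the adapted basis [B i.+1] is the identity truncated after its first i + 1 rows, so vectors
     in its span have no coordinate of index greater than i. *)
  have e : B i.+1 *m invmx (B n) = \matrix_(a, b) ((a == b) && (a < i.+1)%N)%:R.
    apply/row_matrixP => a; rewrite row_mul rowK.
    have -> : (if (a < i.+1)%N then v a else 0) =
              (if (a < i.+1)%N then row a (B n) else 0).
      by rewrite rowK ltn_ord.
    apply/rowP => b; rewrite [RHS]mxE [X in _ = X]mxE; case: ifP => _.
      by rewrite andbT -row_mul mulmxV // !mxE.
    by rewrite andbF mul0mx mxE.
  have -> : T i j = (row i T) 0 j by rewrite [RHS]mxE.
  rewrite /T !row_mul hy -mulmxA e mxE big1 // => a _; rewrite mxE.
  by case: eqP => [->|_]; rewrite ?ltnS 1?leqNgt ?ij mulr0.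
exists (fun i => T i i).
have -> : \tr (A *m A) = \tr (T *m T).
  rewrite /T !mulmxA mulmxKV // [RHS]mxtrace_mulC !mulmxA mulVmx //.
  by rewrite mul1mx.
rewrite /mxtrace; apply: eq_bigr => i _.
(* For j different from i, one of [T i j] and [T j i] lies above the diagonal and vanishes. *)
rewrite mxE (bigD1 i) //= big1 ?addr0 ?expr2 // => j.
rewrite neq_ltn => /orP[] ij; first by rewrite (Tlow j i) ?mulr0.
by rewrite (Tlow i j) ?mul0r.
Qed.

End Flags.

(** The ideals of the chain are stable under ad_u, so the trace is a sum of squares of real diagonal
    entries. *)
Lemma completely_solvable_trace_ad_sqr (R : realType) n
    (br : 'rV[R]_n -> 'rV[R]_n -> 'rV[R]_n) u :
  is_lie_bracket br -> completely_solvable br ->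
  0 <= \tr (ad_mx br u *m ad_mx br u).
Proof.
move=> lie [I [rkI leI idI]].
have [|d ->] := mxtrace_sqr_flag (ad_mx br u) I rkI leI.
  move=> i; apply/row_subP => j; rewrite row_mul mul_ad_mx //.
  by apply: idI; apply: row_sub.
by apply: sumr_ge0 => i _; apply: sqr_ge0.
Qed.

(** * Frames with two null vectors e, ebar and an orthonormal middle part *)

Section Frame.
Context {m : nat}.

(* Indices of e, of the i-th vector of g0, and of ebar in e (+) g0 (+) ebar. *)
Definition fr0 : 'I_(1 + m + 1) := lshift 1 (lshift m (ord0 : 'I_1)).
Definition frm (k : 'I_m) : 'I_(1 + m + 1) := lshift 1 (rshift 1 k).
Definition frL : 'I_(1 + m + 1) := rshift (1 + m) (ord0 : 'I_1).

Definition fr_case {T} (a : T) (b : 'I_m -> T) (c : T) (i : 'I_(1 + m + 1)) : T :=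
  match split i with
  | inl j => match split j with inl _ => a | inr k => b k end
  | inr _ => c
  end.

Lemma fr_case0 T a b c : @fr_case T a b c fr0 = a.
Proof. by rewrite /fr_case (unsplitK (inl _)) (unsplitK (inl _)). Qed.

Lemma fr_casem T a b c k : @fr_case T a b c (frm k) = b k.
Proof. by rewrite /fr_case (unsplitK (inl _)) (unsplitK (inr _)). Qed.

Lemma fr_caseL T a b c : @fr_case T a b c frL = c.
Proof. by rewrite /fr_case (unsplitK (inr _)). Qed.

Definition fr_caseE := (fr_case0, fr_casem, fr_caseL).

Lemma fr_ind (P : 'I_(1 + m + 1) -> Prop) :
  P fr0 -> (forall k, P (frm k)) -> P frL -> forall i, P i.
Proof.
move=> p0 pm pL i; rewrite -(splitK i); case: (split i) => j /=.
  rewrite -(splitK j); case: (split j) => k /=; last exact: pm.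
  by rewrite (ord1 k).
by rewrite (ord1 j).
Qed.

Lemma fr_sum (V : nmodType) (F : 'I_(1 + m + 1) -> V) :
  \sum_i F i = F fr0 + \sum_k F (frm k) + F frL.
Proof. by rewrite big_split_ord big_split_ord !big_ord1. Qed.

Lemma fr_eq : (fr0 == fr0 = true) * (frL == frL = true) * (fr0 == frL = false) *
  (frL == fr0 = false) * (forall k, fr0 == frm k = false) *
  (forall k, frm k == fr0 = false) * (forall k, frL == frm k = false) *
  (forall k, frm k == frL = false) * (forall k l, (frm k == frm l) = (k == l)).
Proof.
have L0 : (frL == fr0) = false by [].
have m0 k : (frm k == fr0) = false by [].
have mL k : (frm k == frL) = false.
  by apply/negbTE; rewrite -val_eqE /= addn0 eqn_add2l neq_ltn ltn_ord.
do !split=> *; rewrite ?eqxx ?m0 ?mL ?L0 // 1?eq_sym ?m0 ?mL ?L0 //.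
Qed.

(* In such a frame <e_i, e_j> is 1 if i = flip j and 0 otherwise. *)
Definition flip : 'I_(1 + m + 1) -> 'I_(1 + m + 1) := fr_case frL frm fr0.

Lemma flip0 : flip fr0 = frL. Proof. exact: fr_case0. Qed.
Lemma flipm k : flip (frm k) = frm k. Proof. exact: fr_casem. Qed.
Lemma flipL : flip frL = fr0. Proof. exact: fr_caseL. Qed.
Definition flipE := (flip0, flipm, flipL).

Lemma flipK : involutive flip.
Proof. by elim/fr_ind => [|k|]; rewrite !flipE. Qed.

Context {R : realType}.
Local Notation dG := (de_G (1%:M : 'M[R]_m)).

Lemma form1 k (u v : 'rV[R]_k) : form 1%:M u v = \sum_i u 0 i * v 0 i.
Proof. by rewrite /form mulmx1 mxE; apply: eq_bigr => i _; rewrite mxE. Qed.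

Lemma de_G1E : dG = \matrix_(i, j) (i == flip j)%:R.
Proof.
apply/matrixP => i j; rewrite !mxE /de_form /de_e /de_ebar form1.
under eq_bigr do rewrite !mxE.
rewrite -/fr0 -/frL !mxE !eqxx /=; move: i j.
elim/fr_ind => [|k|]; elim/fr_ind => [|l|];
  rewrite !flipE !fr_eq ?(mul0r, mulr0, mul1r, add0r, addr0) //=;
  try by (rewrite ?big1 ?addr0 // => p _; rewrite -?/(frm p) ?fr_eq ?(mul0r, mulr0)).
rewrite (bigD1 k) //= -/(frm k) !fr_eq eqxx mul1r big1 ?addr0.
  by rewrite eq_sym.
by move=> p /negbTE pk; rewrite -/(frm p) !fr_eq pk mul0r.
Qed.

(** The Gram matrix is the permutation matrix of the involution [flip], so it raises and lowers
    indices by relabelling them. *)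
Lemma mul_de_G1 k (A : 'M[R]_(k, 1 + m + 1)) i j : (A *m dG) i j = A i (flip j).
Proof.
rewrite mxE (bigD1 (flip j)) //= de_G1E mxE eqxx mulr1 big1 ?addr0 //.
by move=> l /negbTE h; rewrite mxE h mulr0.
Qed.

Lemma de_G1_sym : dG^T = dG.
Proof.
apply/matrixP => i j; rewrite de_G1E !mxE.
by rewrite -(inj_eq (inv_inj flipK)) flipK eq_sym.
Qed.

Lemma de_G1_unit : dG \in unitmx.
Proof.
suff e : dG *m dG = 1%:M by case: (mulmx1_unit e).
by apply/matrixP => i j; rewrite mul_de_G1 de_G1E !mxE flipK.
Qed.

Lemma form_de_G1 (x y : 'rV[R]_(1 + m + 1)) :
  form dG x y = x 0 frL * y 0 fr0 + \sum_k x 0 (frm k) * y 0 (frm k)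
    + x 0 fr0 * y 0 frL.
Proof.
rewrite /form mxE fr_sum !mul_de_G1 !flipE !mxE; congr (_ + _ + _).
by apply: eq_bigr => k _; rewrite mul_de_G1 flipE mxE.
Qed.

Lemma form_de_G1_bvec (x : 'rV[R]_(1 + m + 1)) i :
  form dG x (bvec i) = x 0 (flip i).
Proof. by rewrite form_bvec mul_de_G1. Qed.

(** The frame is built around a standard null vector in Lorentz-orthonormal coordinates, then moved
    by a reflection so that this vector becomes a multiple of [z]. *)
Lemma lightlike_frame (G : 'M[R]_(1 + m + 1)) z :
  lorentzian G -> z != 0 -> form G z z = 0 ->
  exists (F : 'M[R]_(1 + m + 1)) (c : R),
    F *m G *m F^T = dG /\ bvec fr0 *m F = c *: z.
Proof.
move=> [Gs [P [Pu hP]]] z0 zz.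
pose eps (i : 'I_(1 + m + 1)) : R := if val i == 0%N then -1 else 1.
have eps0 : eps fr0 = -1 by [].
have epsm k : eps (frm k) = 1 by [].
have epsL : eps frL = 1 by [].
have formP (x y : 'rV_(1 + m + 1)) :
    form G (x *m P) (y *m P) = \sum_i eps i * (x 0 i * y 0 i).
  rewrite /form trmx_mul !mulmxA -(mulmxA x P) -(mulmxA x _ P^T) hP mxE.
  apply: eq_bigr => i _; rewrite mul_mx_diag !mxE -/(eps i).
  by rewrite mulrAC mulrC.
pose w := z *m invmx P.
have zw : z = w *m P by rewrite mulmxKV.
have ww : w 0 fr0 ^+ 2 = \sum_k w 0 (frm k) ^+ 2 + w 0 frL ^+ 2.
  move: zz; rewrite zw formP fr_sum eps0 epsL.
  under eq_bigr do rewrite epsm mul1r -expr2.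
  by rewrite mulN1r mul1r -!expr2 => h; lra.
have S0 : 0 <= \sum_k w 0 (frm k) ^+ 2 by apply: sumr_ge0 => k _; apply: sqr_ge0.
have w0 : w 0 fr0 != 0.
  apply: contra z0 => /eqP h; rewrite zw; apply/eqP.
  suff -> : w = 0 by rewrite mul0mx.
  have L2 := sqr_ge0 (w 0 frL).
  move: ww; rewrite h expr0n /= => /esym/eqP.
  rewrite paddr_eq0 // => /andP[/eqP sm /eqP sL].
  apply/rowP; elim/fr_ind => [|k|]; rewrite [RHS]mxE //.
    apply/eqP; rewrite -sqrf_eq0; apply/eqP.
    by apply: (psumr_eq0P _ sm) => // l _; apply: sqr_ge0.
  by apply/eqP; rewrite -sqrf_eq0 sL.
(* Rescaling gives time coordinate 1, as in the standard null vector; a null vector with zero time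
   coordinate would vanish. *)
pose c := (w 0 fr0)^-1; pose q := c *: w.
have q0 : q 0 fr0 = 1 by rewrite mxE mulVf.
have qq : \sum_k q 0 (frm k) ^+ 2 + q 0 frL ^+ 2 = 1.
  have -> : \sum_k q 0 (frm k) ^+ 2 = c ^+ 2 * \sum_k w 0 (frm k) ^+ 2.
    by rewrite mulr_sumr; apply: eq_bigr => k _; rewrite mxE exprMn.
  by rewrite mxE exprMn -mulrDr -ww -exprMn mulVf ?expr1n.
have [S [SG Sz]] : exists S : 'M[R]_(1 + m + 1),
    S *m G *m S^T = G /\ (bvec fr0 + bvec frL) *m P *m S = q *m P.
  have [->|ne] := eqVneq q (bvec fr0 + bvec frL).
    by exists 1%:M; rewrite trmx1 mul1mx !mulmx1.
  apply: reflection_isometry => //.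
    have -> : form G (q *m P) (q *m P) = 0.
      rewrite formP fr_sum eps0 epsL q0.
      under eq_bigr do rewrite epsm mul1r -expr2.
      by rewrite -addrA -[1 * (q 0 frL * _)]mul1r !mul1r -expr2 qq mulr1 addNr.
    rewrite formP fr_sum eps0 epsL big1 => [|k _].
      by rewrite !mxE !fr_eq /=; lra.
    by rewrite !mxE !fr_eq /= addr0 !mulr0.
  rewrite -mulmxBl formP fr_sum eps0 epsL.
  set d := q - _.
  (* The two null vectors have the same time coordinate, so their difference is spacelike unless it
     is zero. The identity covers the latter case. *)
  have d0 : d 0 fr0 = 0 by rewrite mxE q0 !mxE !fr_eq /=; lra.
  rewrite d0 mulr0 mulr0 add0r mul1r.
  under eq_bigr do rewrite epsm mul1r -expr2.
  apply: contra ne => /eqP/eqP.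
  rewrite paddr_eq0 ?sqr_ge0 //; last by apply: sumr_ge0 => k _; apply: sqr_ge0.
  case/andP=> /eqP sm; rewrite mulf_eq0 orbb => /eqP sL.
  rewrite -subr_eq0 -/d; apply/eqP/rowP; elim/fr_ind => [|k|]; rewrite [RHS]mxE //.
  apply/eqP; rewrite -sqrf_eq0; apply/eqP.
  by apply: (psumr_eq0P _ sm) => // l _; apply: sqr_ge0.
(* The first and last vectors are null; since [eps] is -1 at [fr0] and 1 at [frL], the factor 1/2
   makes their product 1. *)
pose t : 'I_(1 + m + 1) -> 'rV[R]_(1 + m + 1) :=
  fr_case (bvec fr0 + bvec frL) (fun k => bvec (frm k))
    (2^-1 *: (bvec frL - bvec fr0)).
exists (\matrix_i (t i *m P *m S)), c; split; last first.
  by rewrite bvec_mul rowK /t fr_case0 Sz -scalemxAl -zw.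
apply/matrixP => i j.
rewrite mul_gramE !rowK.
have -> x y : form G (x *m S) (y *m S) = form G x y.
  by rewrite /form trmx_mul !mulmxA -(mulmxA x S G) -(mulmxA x _ S^T) SG.
have fp a b : form G (bvec a *m P) (bvec b *m P) = eps a * (a == b)%:R.
  rewrite formP (bigD1 a) //= big1 ?addr0.
    by rewrite !mxE !eqxx mul1r eq_sym.
  by move=> l /negbTE h; rewrite !mxE h /= mul0r mulr0.
rewrite de_G1E mxE; move: i j; rewrite /t.
elim/fr_ind => [|k|]; elim/fr_ind => [|l|]; rewrite !fr_caseE !flipE !fr_eq;
 rewrite -?scalemxAl ?mulmxDl ?mulNmx ?formZl ?formZr;
 rewrite ?formDl ?formDr ?formNl ?formNr ?fp ?fr_eq ?eps0 ?epsm ?epsL /=; try by lra.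
Qed.

End Frame.

(** * Structure constants of a unimodular Einstein algebra with e central *)

Section AdaptedFrame.
Context {R : realType} {m : nat}.
Local Notation N := (1 + m + 1)%N.
Local Notation dG := (de_G (1%:M : 'M[R]_m)).
Variable br : 'rV[R]_N -> 'rV[R]_N -> 'rV[R]_N.
Hypotheses (lie : is_lie_bracket br) (um : unimodular br).
Hypothesis e0_central : forall v, br (bvec fr0) v = 0.
Hypothesis trace_ad_sqr : forall u, 0 <= \tr (ad_mx br u *m ad_mx br u).
Variable lambda : R.
Hypothesis ein : forall u v, ric_form br dG u v = lambda * form dG u v.
Implicit Types (u v w x y : 'rV[R]_N) (i j k : 'I_m).

Let brDl := br_linl br lie.
Let brDr := br_linr br lie.
Let brC := br_skew br lie.

Let br0r v : br v (bvec fr0) = 0.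
Proof. by rewrite brC e0_central oppr0. Qed.

Let brc (a b p : 'I_N) : R := br (bvec a) (bvec b) 0 p.

Let brcC a b p : brc a b p = - brc b a p.
Proof. by rewrite /brc brC mxE. Qed.

Let brc0l b p : brc fr0 b p = 0.
Proof. by rewrite /brc e0_central mxE. Qed.

Let brc0r a p : brc a fr0 p = 0.
Proof. by rewrite /brc br0r mxE. Qed.

Let brcc a p : brc a a p = 0.
Proof. by have := brcC a a p; lra. Qed.

Let br_coordl x y p : (br x y) 0 p = \sum_a x 0 a * (br (bvec a) y) 0 p.
Proof.
rewrite -(linear_sum_bvec (R^o) (fun x => br x y 0 p)) // => c u v.
by rewrite brDl !mxE.
Qed.

Let br_coordr x y p : (br x y) 0 p = \sum_b y 0 b * (br x (bvec b)) 0 p.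
Proof.
rewrite -(linear_sum_bvec (R^o) (fun y => br x y 0 p)) // => c u v.
by rewrite brDr !mxE.
Qed.

(** The operator R_u with its output index lowered by the metric; [flip] raises it back in
    traces. *)
Let rho u (a b : 'I_N) : R := form dG (LC br dG (bvec a) u) (bvec b).

Let rhoE u a b : rho u a b = 2^-1 * ((br (bvec a) u) 0 (flip b)
  + form dG (br (bvec b) (bvec a)) u + (br (bvec b) u) 0 (flip a)).
Proof. by rewrite /rho LC_form ?de_G1_unit // !form_de_G1_bvec. Qed.

Let rho_bvec a b c : rho (bvec c) a b =
  2^-1 * (brc a c (flip b) + brc b a (flip c) + brc b c (flip a)).
Proof. by rewrite rhoE form_de_G1_bvec. Qed.

Let ric_rho u v :
  ric_form br dG u v = - \sum_a \sum_b rho u a (flip b) * rho v b (flip a).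
Proof.
rewrite ric_unimodular ?de_G1_sym ?de_G1_unit //; congr (- _).
apply: eq_bigr => a _; rewrite mxE; apply: eq_bigr => b _.
by rewrite /rho !form_de_G1_bvec !flipK !mxE.
Qed.

(** An index ebar in one factor is flipped to e in the other, so every term with an index outside g0
    contains a vanishing entry. *)
Let ric_mid u v : (forall a, rho u fr0 a = 0) -> (forall a, rho u a fr0 = 0) ->
  (forall a, rho v fr0 a = 0) -> (forall a, rho v a fr0 = 0) ->
  ric_form br dG u v =
  - \sum_i \sum_j rho u (frm i) (frm j) * rho v (frm j) (frm i).
Proof.
move=> u0l u0r v0l v0r; rewrite ric_rho; congr (- _).
rewrite fr_sum big1 => [|a _]; last by rewrite u0l mul0r.
rewrite add0r [X in _ + X]big1 => [|a _]; last by rewrite flipL v0r mulr0.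
rewrite addr0; apply: eq_bigr => i _.
rewrite fr_sum v0l flipL u0r mulr0 mul0r add0r addr0.
by under eq_bigr do rewrite !flipm.
Qed.

(** On g0 the matrix of [rho] at e is skew with entries <[e_j, e_i], e> / 2, so ric(e, e) is a sum
    of squares. *)
Let brc_mm0 i j : brc (frm i) (frm j) frL = 0.
Proof.
have rl a : rho (bvec fr0) fr0 a = 0.
  by rewrite rho_bvec !(brc0l, brc0r) !addr0 mulr0.
have rr a : rho (bvec fr0) a fr0 = 0.
  by rewrite rho_bvec !(brc0l, brc0r) !addr0 mulr0.
have := ein (bvec fr0) (bvec fr0).
rewrite form_de_G1_bvec flip0 mxE fr_eq mulr0 ric_mid // => /eqP.
rewrite oppr_eq0 => /eqP h.
have e a b : rho (bvec fr0) (frm a) (frm b) * rho (bvec fr0) (frm b) (frm a) =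
             - (2^-1 * brc (frm a) (frm b) frL) ^+ 2.
  rewrite !rho_bvec !brc0r flip0 (brcC (frm b)); ring.
move: h; under eq_bigr do under eq_bigr do rewrite e.
under eq_bigr do rewrite sumrN; rewrite sumrN => /eqP; rewrite oppr_eq0 => /eqP h.
have := psumr_eq0P (fun a _ => sumr_ge0 _ (fun b _ => sqr_ge0 _)) h.
move=> /(_ i isT) /(psumr_eq0P (fun b _ => sqr_ge0 _)) /(_ j isT) /eqP.
by rewrite sqrf_eq0 mulf_eq0 invr_eq0 pnatr_eq0 /= => /eqP.
Qed.

(** Since <e, ebar> = 1, the Einstein constant is ric(e, ebar), which is computed directly. *)
Lemma adapted_lambda0 : lambda = 0.
Proof.
have := ein (bvec fr0) (bvec frL).
rewrite form_de_G1_bvec flipL mxE fr_eq mulr1 ric_rho => <-.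
apply/eqP; rewrite oppr_eq0; apply/eqP.
have r0l a : rho (bvec fr0) fr0 a = 0.
  by rewrite rho_bvec !(brc0l, brc0r) !addr0 mulr0.
have r0r a : rho (bvec fr0) a fr0 = 0.
  by rewrite rho_bvec !(brc0l, brc0r) !addr0 mulr0.
have rmm i j : rho (bvec fr0) (frm i) (frm j) = 0.
  by rewrite rho_bvec !brc0r flip0 brc_mm0 !addr0 mulr0.
have rLL : rho (bvec fr0) frL frL = 0.
  by rewrite rho_bvec !brc0r flip0 brcc !addr0 mulr0.
rewrite !fr_sum big1 => [|k _]; last by rewrite r0l mul0r.
rewrite !flipE !r0l !r0r rLL !mul0r !add0r !addr0.
(* For each k the entries of [rho] at e in positions (k, ebar) and (ebar, k) are opposite, while the
   matching entries at ebar are equal; the two contributions cancel. *)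
rewrite -big_split /=; apply: big1 => k _.
rewrite fr_sum big1 => [|l _]; last by rewrite !flipm rmm mul0r.
rewrite !flipE r0r mul0r !addr0 !rho_bvec !(brc0l, brc0r) !flipE.
rewrite (brcC frL (frm k)); ring.
Qed.

Let ric0 u v : ric_form br dG u v = 0.
Proof. by rewrite ein adapted_lambda0 mul0r. Qed.

Let al k : R := brc (frm k) frL frL.

(** The coordinate at [frL] is the product with e. Brackets of e_i with e and g0 have none, so only
    the ebar part of x contributes. *)
Let br_mid_L i x : (br (bvec (frm i)) x) 0 frL = x 0 frL * al i.
Proof.
rewrite br_coordr fr_sum -/(brc _ _ _) brc0r mulr0 add0r big1 ?add0r // => k _.
by rewrite -/(brc _ _ _) brc_mm0 mulr0.
Qed.

Let br_L_L x : (br (bvec frL) x) 0 frL = - \sum_k x 0 (frm k) * al k.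
Proof.
rewrite br_coordr fr_sum -!/(brc _ _ _) brc0r brcc !mulr0 add0r addr0 -sumrN.
by apply: eq_bigr => k _; rewrite -/(brc _ _ _) brcC mulrN.
Qed.

(** Take the ebar coordinate of the Jacobi identity for e_i, e_j, ebar: the first two terms are
    [al i * al j] with opposite signs. *)
Let jacobi_al i j : \sum_k brc (frm i) (frm j) (frm k) * al k = 0.
Proof.
case: lie => _ _ /(_ (bvec (frm i)) (bvec (frm j)) (bvec frL)).
move=> /(congr1 (fun x : 'rV[R]_N => x 0 frL)); rewrite /= !mxE.
have e1 : (br (bvec frL) (bvec (frm i))) 0 frL = - al i by exact: brcC.
have e2 : (br (bvec (frm j)) (bvec frL)) 0 frL = al j by [].
rewrite (br_mid_L i (br _ _)) (br_mid_L j (br _ _)) (br_L_L (br _ _)) e1 e2.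
by rewrite /brc => h; move: h; lra.
Qed.

(* For A = sum_k (al k) e_k, the Jacobi identity makes rho A symmetric, hence
   0 = - ric(A, A) = |A|^4 / 2 + sum_ij (rho A e_i e_j)^2. *)
Let al0 k : al k = 0.
Proof.
pose A : 'rV[R]_N := \row_a fr_case 0 al 0 a.
have A0 : A 0 fr0 = 0 by rewrite mxE fr_case0.
have Am l : A 0 (frm l) = al l by rewrite mxE fr_casem.
have AL : A 0 frL = 0 by rewrite mxE fr_caseL.
have formA x : form dG x A = \sum_k x 0 (frm k) * al k.
  rewrite form_de_G1 A0 AL !mulr0 add0r addr0.
  by apply: eq_bigr => l _; rewrite Am.
pose nu := \sum_k al k ^+ 2.
have bLA : (br (bvec frL) A) 0 frL = - nu.
  by rewrite br_L_L; congr (- _); apply: eq_bigr => l _; rewrite Am.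
have bmA i : (br (bvec (frm i)) A) 0 frL = 0 by rewrite br_mid_L AL mul0r.
have b0A : br (bvec fr0) A = 0 by exact: e0_central.
have f0 x : form dG 0 x = 0 by exact: form0l.
have r00 : rho A fr0 fr0 = 0.
  by rewrite rhoE !e0_central f0 mxE !addr0 mulr0.
have r0m i : rho A fr0 (frm i) = 0.
  by rewrite rhoE br0r b0A f0 flip0 bmA mxE !addr0 mulr0.
have rm0 i : rho A (frm i) fr0 = 0.
  by rewrite rhoE e0_central b0A f0 flip0 bmA mxE !addr0 mulr0.
have r0L : rho A fr0 frL = - nu / 2.
  by rewrite rhoE b0A br0r f0 flip0 bLA mxE; ring.
have rL0 : rho A frL fr0 = - nu / 2.
  by rewrite rhoE b0A e0_central f0 flip0 bLA mxE; ring.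
have rmm i j : rho A (frm i) (frm j) = rho A (frm j) (frm i).
  by rewrite !rhoE !formA !jacobi_al !flipm; ring.
(* The vanishing entries [r00], [r0m] and [rm0] annihilate every product containing an uncomputed
   entry such as [rho A frL frL]. *)
have e0 : \sum_b rho A fr0 (flip b) * rho A b (flip fr0) = (nu / 2) ^+ 2.
  rewrite fr_sum !flipE r00 r0L mul0r addr0 big1 ?addr0; first by ring.
  by move=> i _; rewrite !flipE r0m mul0r.
have eL : \sum_b rho A frL (flip b) * rho A b (flip frL) = (nu / 2) ^+ 2.
  rewrite fr_sum !flipE r00 rL0 mulr0 add0r big1 ?add0r; first by ring.
  by move=> i _; rewrite !flipE rm0 mulr0.
have em : \sum_i \sum_b rho A (frm i) (flip b) * rho A b (flip (frm i)) =
          \sum_i \sum_j rho A (frm i) (frm j) ^+ 2.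
  apply: eq_bigr => i _; rewrite fr_sum !flipE r0m rm0 mulr0 mul0r add0r addr0.
  by apply: eq_bigr => j _; rewrite !flipE expr2 -rmm.
have := ric0 A A; rewrite ric_rho fr_sum e0 eL em => /eqP; rewrite oppr_eq0.
move=> /eqP h.
have S0 : 0 <= \sum_i \sum_j rho A (frm i) (frm j) ^+ 2.
  by apply: sumr_ge0 => i _; apply: sumr_ge0 => j _; apply: sqr_ge0.
have nu0 : nu = 0 by nra.
apply/eqP; rewrite -sqrf_eq0; apply/eqP.
by apply: (psumr_eq0P _ nu0) => // l _; apply: sqr_ge0.
Qed.

Let brcL a b : brc a b frL = 0.
Proof.
move: a; elim/(@fr_ind m) => [|i|]; first by rewrite brc0l.
  by rewrite /brc br_mid_L al0 mulr0.
by rewrite /brc br_L_L big1 ?oppr0 // => k _; rewrite al0 mulr0.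
Qed.

(** The e row of ad e_k vanishes by centrality and its ebar column by [brcL], so only the g0 block
    contributes. *)
Let trace_ad_mid k : \tr (ad_mx br (bvec (frm k)) *m ad_mx br (bvec (frm k))) =
  \sum_i \sum_j brc (frm k) (frm i) (frm j) * brc (frm k) (frm j) (frm i).
Proof.
pose c a b := brc (frm k) a b.
have -> : \tr (ad_mx br (bvec (frm k)) *m ad_mx br (bvec (frm k))) =
          \sum_a \sum_b c a b * c b a.
  apply: eq_bigr => a _; rewrite mxE; apply: eq_bigr => b _.
  by rewrite !mxE.
have c0 b : c fr0 b = 0 by exact: brc0r.
have cL a : c a frL = 0 by exact: brcL.
rewrite fr_sum big1 ?add0r => [|b _]; last by rewrite c0 mul0r.
rewrite [X in _ + X]big1 ?addr0 => [|b _]; last by rewrite cL mulr0.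
by apply: eq_bigr => i _; rewrite fr_sum c0 cL mulr0 mul0r add0r addr0.
Qed.

(* Summing - 4 ric(e_k, e_k) over g0 gives
   sum |[e_i, e_j]|^2 + 2 sum_k tr (ad e_k)^2, two nonnegative terms. *)
Let brc_mmm i j k : brc (frm i) (frm j) (frm k) = 0.
Proof.
pose c i j k := brc (frm i) (frm j) (frm k).
have cC a b d : c a b d = - c b a d by exact: brcC.
pose n2 := \sum_k \sum_i \sum_j c k i j ^+ 2.
pose t := \sum_k \sum_i \sum_j c k i j * c k j i.
have t0 : 0 <= t.
  by apply: sumr_ge0 => a _; rewrite -trace_ad_mid; apply: trace_ad_sqr.
(* Splitting [rho] at e_a into symmetric and skew parts on g0, the product of two transposed entries
   is a difference of squares. *)
have r a : \sum_i \sum_j (2^-1) ^+ 2 * (c a i j ^+ 2 + c a j i ^+ 2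
      + 2 * (c a i j * c a j i) - c i j a ^+ 2) = 0.
  have := ric0 (bvec (frm a)) (bvec (frm a)).
  rewrite ric_mid => [/eqP|b|b|b|b]; last 4 first.
  - by rewrite rho_bvec !(brc0l, brc0r, flip0, brcL) !addr0 mulr0.
  - by rewrite rho_bvec !(brc0l, brc0r, flip0, brcL) !addr0 mulr0.
  - by rewrite rho_bvec !(brc0l, brc0r, flip0, brcL) !addr0 mulr0.
  - by rewrite rho_bvec !(brc0l, brc0r, flip0, brcL) !addr0 mulr0.
  rewrite oppr_eq0 => /eqP h; rewrite -[RHS]h.
  apply: eq_bigr => p _; apply: eq_bigr => q _.
  rewrite !rho_bvec !flipm -!/(c _ _ _) (cC p a) (cC q a) (cC q p); ring.
have h : n2 + 2 * t = 0.
  have : \sum_a (\sum_i \sum_j (2^-1) ^+ 2 * (c a i j ^+ 2 + c a j i ^+ 2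
      + 2 * (c a i j * c a j i) - c i j a ^+ 2)) = 0 by apply: big1 => a _.
  under eq_bigr do under eq_bigr do rewrite -mulr_sumr sumrB !big_split /= -mulr_sumr.
  under eq_bigr do rewrite -mulr_sumr sumrB !big_split /= -mulr_sumr.
  rewrite -mulr_sumr sumrB !big_split /= -mulr_sumr -/n2 -/t.
  (* After renaming indices all three sums of squares equal [n2], two with sign plus and one with
     sign minus. *)
  have -> : \sum_a \sum_i \sum_j c a j i ^+ 2 = n2.
    by apply: eq_bigr => a _; rewrite exchange_big.
  have -> : \sum_a \sum_i \sum_j c i j a ^+ 2 = n2.
    by rewrite exchange_big; apply: eq_bigr => a _; rewrite exchange_big.
  lra.
have n0 : n2 = 0.
  have : 0 <= n2.
    apply: sumr_ge0 => a _; apply: sumr_ge0 => b _; apply: sumr_ge0 => d _.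
    exact: sqr_ge0.
  lra.
have h1 := psumr_eq0P (fun a _ => sumr_ge0 _ (fun b _ =>
  sumr_ge0 _ (fun d _ => sqr_ge0 _))) n0.
have h2 := psumr_eq0P (fun b _ => sumr_ge0 _ (fun d _ => sqr_ge0 _)) (h1 i isT).
have h3 := psumr_eq0P (fun d _ => sqr_ge0 _) (h2 j isT).
by have /eqP := h3 k isT; rewrite sqrf_eq0 => /eqP.
Qed.

(** What survives is the e part of [e_i, e_j], giving [K], and the g0 and e parts of [ebar, e_i],
    giving [D] and [b]; centrality of e gives mu = 0. *)
Lemma adapted_double_extension : exists (K D : 'M[R]_m) (b : 'rV[R]_m),
  skew_wrt 1%:M K /\ forall x y, br x y = de_br 1%:M K D 0 b x y.
Proof.
pose K : 'M[R]_m := \matrix_(i, j) brc (frm i) (frm j) fr0.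
pose D : 'M[R]_m := \matrix_(i, j) brc frL (frm i) (frm j).
pose b : 'rV[R]_m := \row_i brc frL (frm i) fr0.
exists K, D, b; split.
  have KT : K^T = - K by apply/matrixP => i j; rewrite !mxE brcC.
  by move=> u v; rewrite /form !mulmx1 trmx_mul KT mulNmx mulmxN mulmxA [in RHS]mxE opprK.
move=> x y; apply/rowP.
have coord p : (br x y) 0 p =
    \sum_i x 0 (frm i) * (\sum_j y 0 (frm j) * brc (frm i) (frm j) p)
    + \sum_i (x 0 frL * y 0 (frm i) - y 0 frL * x 0 (frm i)) * brc frL (frm i) p.
  rewrite br_coordl fr_sum e0_central mxE mulr0 add0r.
  rewrite (br_coordr (bvec frL)) fr_sum -!/(brc _ _ _) brc0r brcc !mulr0 add0r addr0.
  rewrite mulr_sumr -!big_split /=.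
  apply: eq_bigr => i _.
  rewrite (br_coordr (bvec (frm i))) fr_sum -!/(brc _ _ _) brc0r mulr0 add0r.
  by rewrite (brcC (frm i) frL); ring.
rewrite /de_br /de_mk.
have midE u i : de_mid u 0 i = u 0 (frm i) by rewrite mxE.
elim/(@fr_ind m) => [|k|]; rewrite ?row_mxEl ?row_mxEr coord !mxE.
- rewrite eqxx mulr1n mul0r addr0 !form1 -addrA; congr (_ + _).
    under eq_bigr do rewrite mulr_sumr.
    rewrite exchange_big /=; apply: eq_bigr => l _.
    rewrite midE [(_ *m K) _ _]mxE mulr_suml; apply: eq_bigr => i _.
    by rewrite midE mxE mulrCA mulrC -mulrA mulrCA.
  rewrite !mulr_sumr -sumrB; apply: eq_bigr => i _.
  by rewrite !midE mxE /de_ebar -/frL; ring.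
- rewrite big1 ?add0r => [|i _]; last first.
    by rewrite big1 ?mulr0 // => j _; rewrite brc_mmm mulr0.
  rewrite !mulr_sumr -sumrB; apply: eq_bigr => i _.
  by rewrite !midE mxE /de_ebar -/frL; ring.
- rewrite mul0rn !big1 ?addr0 // => i _; first by rewrite brcL mulr0.
  by rewrite big1 ?mulr0 // => j _; rewrite brcL mulr0.
Qed.

End AdaptedFrame.

(** * Nondegeneracy and dimension of Lorentzian spaces *)

Section Lorentzian.
Context {R : realType} {n : nat} (G : 'M[R]_n).
Hypothesis lor : lorentzian G.

Lemma lorentzian_unit : G \in unitmx.
Proof.
case: lor => _ [P [Pu hP]]; set d := diag_mx _ in hP.
have dd : d *m d = 1%:M.
  apply/matrixP => i j; rewrite mul_diag_mx !mxE.
  case: (i == j); rewrite ?mulr0n ?mulr0 // !mulr1n.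
  by case: ifP => _; rewrite ?mulrNN mulr1.
have : P *m (G *m P^T *m d) = 1%:M by rewrite !mulmxA hP dd.
move=> /mulmx1C; rewrite -!mulmxA => e.
by case: (mulmx1_unit e).
Qed.

(** A nonzero null vector excludes dimension 0 and also dimension 1, where the form is negative
    definite. *)
Lemma lightlike_dim (z : 'rV[R]_n) :
  z != 0 -> form G z z = 0 -> exists m, n = (1 + m + 1)%N.
Proof.
case: lor => _ [P [Pu hP]]; case: n G z P Pu hP => [|[|m]] G' z P Pu hP.
- by rewrite (thinmx0 z) eqxx.
- have zw : z = z *m invmx P *m P by rewrite mulmxKV.
  rewrite zw; move: (z *m invmx P) => w w0.
  rewrite /form trmx_mul !mulmxA -(mulmxA w P) -(mulmxA w _ P^T) hP.
  rewrite mul_mx_diag mxE big_ord1 !mxE /= mulrN1 mulNr => /eqP.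
  rewrite oppr_eq0 mulf_eq0 orbb => /eqP e; case/eqP: w0.
  suff -> : w = 0 by rewrite mul0mx.
  by apply/rowP => i; rewrite (ord1 i) e mxE.
- by exists m; rewrite add1n addn1.
Qed.

End Lorentzian.

(** * Passage to the adapted frame and the equivalence *)

Lemma euclidean1 (R : realType) m : euclidean (1%:M : 'M[R]_m).
Proof.
split=> [|u u0]; first exact: trmx1.
have s0 : 0 <= form 1%:M u u by rewrite form1; apply: sumr_ge0 => i _; apply: sqr_ge0.
rewrite lt_neqAle s0 andbT eq_sym; apply: contra u0; rewrite form1 => /eqP h.
apply/eqP/rowP => i; rewrite mxE; apply/eqP; rewrite -sqrf_eq0 expr2.
by apply/eqP; apply: (psumr_eq0P _ h) => // j _; apply: sqr_ge0.
Qed.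

Lemma einstein_double_extension (R : realType) (n : nat)
    (br : 'rV[R]_n -> 'rV[R]_n -> 'rV[R]_n) (G : 'M[R]_n) (z : 'rV[R]_n) lambda :
  is_lie_bracket br -> lorentzian G ->
  completely_solvable br -> unimodular br ->
  z != 0 -> central br z -> form G z z = 0 ->
  (forall u, Ric br G u = lambda *: u) ->
  lambda = 0 /\ exists (m : nat) (K D : 'M[R]_m) (b : 'rV[R]_m),
    skew_wrt 1%:M K /\ isometric_iso br G (de_br 1%:M K D 0 b) (de_G 1%:M).
Proof.
move=> lie lor cs um z0 zc zz ein.
have [m nm] := lightlike_dim G lor z z0 zz; subst n.
have Gu := lorentzian_unit G lor.
have [F [c [hF Fz]]] := lightlike_frame G z lor z0 zz.
have Fu : F \in unitmx.
  have : F *m (G *m F^T *m invmx (de_G 1%:M)) = 1%:M.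
    by rewrite !mulmxA hF mulmxV // de_G1_unit.
  by case/mulmx1_unit.
have fg := mulVmx Fu; have gf := mulmxV Fu.
(* The rows of [F] are the frame vectors, so [br'] is the bracket in frame coordinates and [invmx F]
   is the isometry onto the model. *)
pose br' x y := br (x *m F) (y *m F) *m invmx F.
have hbr x y : br' (x *m invmx F) (y *m invmx F) = br x y *m invmx F.
  by rewrite /br' !mulmxKV.
have hG x y : form (de_G 1%:M) (x *m invmx F) (y *m invmx F) = form G x y.
  by rewrite -hF /form !mulmxA mulmxKV // -[x *m G *m F^T *m _]mulmxA
    -trmx_mul mulmxKV.
have lie' := iso_lie br br' (invmx F) F fg gf hbr lie.
have um' := iso_unimodular br br' (invmx F) F fg gf hbr lie um.
have ein' : forall u v,
    ric_form br' (de_G 1%:M) u v = lambda * form (de_G 1%:M) u v.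
  apply/(einsteinP br' _ lie' de_G1_unit lambda).
  exact: (iso_einstein br G br' _ (invmx F) F fg gf hbr hG lie Gu lambda ein).
have e0 v : br' (bvec fr0) v = 0.
  rewrite /br' Fz -[c *: z]addr0 (br_linl br lie) zc scaler0 add0r.
  have -> : br 0 (v *m F) = 0 by have := br_linl br lie (-1) 0 0 (v *m F);
    rewrite scaleN1r addNr scaleN1r addNr.
  by rewrite mul0mx.
have tr2 u : 0 <= \tr (ad_mx br' u *m ad_mx br' u).
  rewrite -[u](mulmxK Fu) (iso_trace_ad_sqr br br' (invmx F) F fg gf hbr lie).
  exact: completely_solvable_trace_ad_sqr.
split; first exact: (adapted_lambda0 br' lie' um' e0 lambda ein').
have [K [D [b [Ks hde]]]] :=
  adapted_double_extension br' lie' um' e0 tr2 lambda ein'.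
exists m, K, D, b; split=> //; exists (invmx F), F; split=> // x y.
by rewrite -hde hbr.
Qed.

Theorem theorem4p4 (R : realType) (n : nat)
  (br : 'rV[R]_n -> 'rV[R]_n -> 'rV[R]_n) (G : 'M[R]_n) :
  is_lie_bracket br -> lorentzian G ->
  completely_solvable br -> unimodular br ->
  center_nonzero br -> center_degenerate G br ->
  (einstein br G <->
     exists (m : nat) (G0 K D : 'M[R]_m) (b : 'rV[R]_m),
       [/\ euclidean G0, skew_wrt G0 K, admissible G0 K D 0 b
         & isometric_iso br G (de_br G0 K D 0 b) (de_G G0)])
  /\ (einstein br G -> ricci_flat br G).
Proof.
move=> lie lor cs um _ [z [z0 zc zd]].
(* The degeneracy vector is central, so it is orthogonal to itself. *)
have zz := zd z zc; have Gu := lorentzian_unit G lor.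
have fwd := einstein_double_extension R n br G z _ lie lor cs um z0 zc zz.
split; last first.
  case=> lambda ein u; case: (fwd lambda ein) => l0 _.
  by rewrite ein l0 scale0r.
split.
  case=> lambda ein; case: (fwd lambda ein) => _ [m [K [D [b [Ks iso]]]]].
  (* The middle part of the frame is orthonormal, hence the identity Gram matrix. Admissibility is
     transported from [br] along the isometry. *)
  exists m, 1%:M, K, D, b; split=> //; first exact: euclidean1.
  case: iso => f [g [fg gf hbr hG]]; split.
    exact: (iso_lie br _ f g fg gf hbr lie).
  exists lambda.
  exact: (iso_einstein br G _ _ f g fg gf hbr hG lie Gu lambda ein).
(* Conversely, admissibility contains the Einstein condition for the model, which the inverse
   isometry carries back to [br]. *)
case=> m [G0 [K [D [b [_ _ [lie' [lambda ein]] iso]]]]].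
have G'u : de_G G0 \in unitmx.
  case: iso => f [g [fg gf _ hG]].
  exact: (iso_unit G _ f g fg gf hG Gu).
have [f [g [fg gf hbr hG]]] := isometric_iso_sym _ _ _ _ iso.
exists lambda.
exact: (iso_einstein _ _ br G f g fg gf hbr hG lie' G'u lambda ein).
Qed.
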